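(* Let $X$ be a nonempty finite set and let $\theta_X$ be a saturated formigram over $X$ with bounded support and critical points in $\mathbb{Z}$. Then the zigzag barcode $\mathrm{barc}_{\mathbf{ZZ}}(\theta_X)$ is equal to the silhouette $|\mathrm{dgm}^{\Diamond}(\theta_X)|$ of the persistence clustergram of $\theta_X$; that is, every interval in $\mathrm{barc}_{\mathbf{ZZ}}(\theta_X)$ belongs to $\mathcal{I}$, and for every $I\in\mathcal{I}$ the multiplicity of $I$ in $\mathrm{barc}_{\mathbf{ZZ}}(\theta_X)$ is $|\mathrm{dgm}^{\Diamond}(\theta_X)|(I)$.
   Context: Subpartitions. A subpartition of $X$ is a partition $P$ of a (possibly empty) subset of $X$; its elements are blocks and $\bigcup P$ is its underlying set. $\mathrm{SubPart}(X)$ is the lattice of all subpartitions of $X$, ordered by $P\le Q$ iff every block of $P$ is contained in some block of $Q$; $\vee$ is the finest common coarsening and $\wedge$ the coarsest common refinement. Formigrams. A formigram over $X$ is a map $\theta_X:\mathbb{R}\to\mathrm{SubPart}(X)$ such that (a) there is a locally finite set $C\subset\mathbb{R}$ of critical points such that $\theta_X$ is constant on each connected component of $\mathbb{R}\setminus C$ and for every $c\in C$ there is $r_c>0$ with $\theta_X(c-\varepsilon)\le\theta_X(c)\ge\theta_X(c+\varepsilon)$ for all $\varepsilon\in[0,r_c)$; (b) for each $x\in X$ there is a (nonempty) closed interval $I_x\subset\mathbb{R}$ (lifespan) with $x\in\bigcup\theta_X(t)$ iff $t\in I_x$. The support is $\bigcup_xI_x$; ''critical points in $\mathbb{Z}$''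 means $C\subset\mathbb{Z}$ can be chosen. $\theta_X$ is saturated if all $x\in X$ have the same lifespan. For an interval $I$, $\bigvee_I\theta_X=\bigvee\{\theta_X(t):t\in I\}$ and $\bigwedge_I\theta_X=\bigwedge\{\theta_X(t):t\in I\}$; with $X'=\bigcup\big(\bigwedge_I\theta_X\big)$, $\Diamond_I\theta_X=\{B\cap X':B\in\bigvee_I\theta_X,\ B\cap X'\neq\emptyset\}$. $\mathcal{I}$ is the set of nonempty bounded intervals of $\mathbb{R}$ (open, closed or half-open) with integer endpoints. For $I\in\mathcal{I}$, $I^-$ is the smallest element of $\mathcal{I}$ strictly enlarging $I$ only on the left (a left end ''$(b$'' becomes ''$[b$'', ''$[b$'' becomes ''$(b-1$''); $I^+$ is the smallest element strictly enlarging $I$ only on the right (''$d)$'' becomes ''$d]$'', ''$d]$'' becomes ''$d+1)$''); $I^\pm=I^-\cup I^+$. $\mathbb{Z}\,\mathrm{pow}(X)$ is the free abelian group on the power set of $X$; a subpartition $\{B_i\}_i$ is identified with $\sum_i1\cdot B_i$. The persistence clustergram is $\mathrm{dgm}^{\Diamond}(\theta_X):\mathcal{I}\to\mathbb{Z}\,\mathrm{pow}(X)$, $\mathrm{dgm}^{\Diamond}(\theta_X)(I)=\Diamond_I\theta_X-\Diamond_{I^+}\theta_X-\Diamond_{I^-}\theta_X+\Diamond_{I^\pm}\theta_X$. Its silhouette $|\mathrm{dgm}^{\Diamond}(\theta_X)|:\mathcal{I}\to\mathbb{Z}$ is obtained by applying to each value the homomorphism $\sum_im_iB_i\mapsto\sum_im_i$.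 Zigzag barcode. Fix a field $\mathbb{F}$. Let $\mathbf{Int}$ be the poset of nonempty bounded closed real intervals ordered by inclusion. Let $F_{\theta_X}:\mathbf{Int}\to\mathbf{vec}$ (finite-dimensional $\mathbb{F}$-vector spaces) send $I$ to the vector space with basis the set of blocks $\bigvee_I\theta_X$, and $I\subset J$ to the linear extension of the map sending a block to the unique block of $\bigvee_J\theta_X$ containing it. An interval of a poset is a nonempty, convex subset that is connected (any two elements are joined by a finite sequence of consecutively comparable elements of it); the interval module of $\mathcal{J}$ is $\mathbb{F}$ on $\mathcal{J}$ with identity maps and $0$ elsewhere. It is known that $F_{\theta_X}$ is isomorphic to a direct sum of interval modules over a unique multiset $\mathrm{barc}(F_{\theta_X})$ of intervals of $\mathbf{Int}$. $\mathrm{barc}_{\mathbf{ZZ}}(\theta_X)$ is the multiset of the (nonempty) real intervals $\{t\in\mathbb{R}:[t,t]\in\mathcal{J}\}$, $\mathcal{J}\in\mathrm{barc}(F_{\theta_X})$. *)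

(* Defs.v *)
From HB Require Import structures.
From mathcomp Require Import all_boot all_order all_algebra.

Set Implicit Arguments.
Unset Strict Implicit.
Unset Printing Implicit Defensive.

Import Order.TTheory GRing.Theory Num.Theory.

Local Open Scope ring_scope.

Section SubPart.
Variable X : finType.

Record subpart := SubPart {
  blocks_of :> {set {set X}};
  subpart_partition : partition blocks_of (cover blocks_of) }.

HB.instance Definition _ := [isSub for blocks_of].
HB.instance Definition _ := [Finite of subpart by <:].

Implicit Types (P Q S : subpart) (B C : {set X}) (x y z : X).

Definition subpart_le P Q : bool :=
  [forall B in (P : {set {set X}}), [exists C in (Q : {set {set X}}), B \subset C]].

(* [x] and [y] lie in a common block of [P]; such relations are exactly the
   partial equivalence relations on [X]. *)
Definition same_block P x y : bool :=
  [exists B in (P : {set {set X}}), (x \in B) && (y \in B)].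

Lemma subpart_trivIset P : trivIset P.
Proof. by case: P => P /= /and3P[]. Qed.

Lemma subpart_set0 P : set0 \notin (P : {set {set X}}).
Proof. by case: P => P /= /and3P[]. Qed.

Lemma block_uniq P B C x : B \in blocks_of P ->
  C \in blocks_of P -> x \in B -> x \in C -> B = C.
Proof.
move=> PB PC xB xC; apply/eqP; apply/negPn/negP => BC.
have /trivIsetP/(_ _ _ PB PC BC) := subpart_trivIset P.
by move/pred0P/(_ x); rewrite /= xB xC.
Qed.

Lemma block_neq0 P B : B \in blocks_of P -> exists x, x \in B.
Proof.
move=> PB; apply/set0Pn; apply: contraNneq (subpart_set0 P) => <-; exact: PB.
Qed.

Lemma same_blockP P x y :
  reflect (exists B, [/\ B \in blocks_of P, x \in B & y \in B])
          (same_block P x y).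
Proof.
apply: (iffP existsP) => [[B /and3P[]]|[B [PB xB yB]]]; exists B => //.
by rewrite PB xB.
Qed.

Lemma same_block_sym P : symmetric (same_block P).
Proof.
by move=> x y; apply/same_blockP/same_blockP => -[B [PB xB yB]]; exists B.
Qed.

Lemma same_block_trans P : transitive (same_block P).
Proof.
move=> y x z /same_blockP[B [PB xB yB]] /same_blockP[C [PC yC zC]].
by apply/same_blockP; exists B; split=> //; rewrite (block_uniq PB PC yB yC).
Qed.

Lemma same_block_cover P x : same_block P x x = (x \in cover P).
Proof.
apply/same_blockP/bigcupP => [[B [PB xB _]]|[B PB xB]]; first by exists B.
by exists B.
Qed.

Lemma subpart_leP P Q :
  reflect (forall x y, same_block P x y -> same_block Q x y) (subpart_le P Q).
Proof.
apply: (iffP forall_inP) => [PQ x y /same_blockP[B [PB xB yB]]|PQ B PB].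
  have /exists_inP[C QC /subsetP BC] := PQ _ PB.
  by apply/same_blockP; exists C; rewrite !BC.
have [x xB] := block_neq0 PB.
have /PQ/same_blockP[C [QC xC _]] : same_block P x x.
  by apply/same_blockP; exists B.
apply/exists_inP; exists C => //; apply/subsetP => y yB.
have /PQ/same_blockP[D [QD xD yD]] : same_block P x y.
  by apply/same_blockP; exists B.
by rewrite (block_uniq QC QD xC xD).
Qed.

Lemma subpart_eqP P Q : same_block P =2 same_block Q -> P = Q.
Proof.
have sub P1 P2 : same_block P1 =2 same_block P2 ->
    {subset (P1 : {set {set X}}) <= (P2 : {set {set X}})}.
  move=> PQ B PB; have [x xB] := block_neq0 PB.
  have : same_block P1 x x by apply/same_blockP; exists B.
  rewrite PQ => /same_blockP[C [QC xC _]].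
  suff -> : B = C by [].
  apply/setP => y; apply/idP/idP => [yB|yC].
    have : same_block P1 x y by apply/same_blockP; exists B.
    rewrite PQ => /same_blockP[D [QD xD yD]].
    by rewrite (block_uniq QC QD xC xD).
  have : same_block P2 x y by apply/same_blockP; exists C.
  rewrite -PQ => /same_blockP[D [PD xD yD]].
  by rewrite (block_uniq PB PD xB xD).
move=> PQ; apply/val_inj/setP => B /=.
by apply/idP/idP; apply: sub => // x y; rewrite PQ.
Qed.

Definition per_classes (e : rel X) : {set {set X}} :=
  equivalence_partition e [set x | e x x].

Lemma per_classes_partition (e : rel X) : symmetric e -> transitive e ->
  partition (per_classes e) (cover (per_classes e)).
Proof.
move=> es et; have ee : {in [set x | e x x] & &, equivalence_rel e}.
  move=> x y z; rewrite !inE => exx eyy ezz; split=> // exy.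
  by apply/idP/idP; apply: et; rewrite // es.
have := equivalence_partitionP ee; rewrite -/(per_classes e) => h.
by rewrite (cover_partition h).
Qed.

Definition per_subpart (e : rel X) (es : symmetric e) (et : transitive e) :=
  SubPart (per_classes_partition es et).

Lemma same_block_per e (es : symmetric e) (et : transitive e) :
  same_block (per_subpart es et) =2 e.
Proof.
move=> x y; apply/same_blockP/idP => /= [[B [/imsetP[z]]]|exy].
  rewrite inE => ezz ->; rewrite !inE => /andP[exx ezx] /andP[eyy ezy].
  by apply: (et z); rewrite // es.
have exx : e x x by apply: (et y); rewrite // es.
have eyy : e y y by apply: (et x); rewrite // es.
exists [set z in [set x | e x x] | e x z].
by rewrite !inE exx exy eyy; split=> //; apply: imset_f; rewrite inE.
Qed.

Definition meet_rel P Q : rel X := fun x y => same_block P x y && same_block Q x y.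

Lemma meet_rel_sym P Q : symmetric (meet_rel P Q).
Proof.
by move=> x y; rewrite /meet_rel same_block_sym (same_block_sym Q).
Qed.

Lemma meet_rel_trans P Q : transitive (meet_rel P Q).
Proof.
move=> y x z /andP[Pxy Qxy] /andP[Pyz Qyz]; apply/andP.
by split; apply: same_block_trans; eassumption.
Qed.

Definition subpart_meet P Q :=
  per_subpart (@meet_rel_sym P Q) (@meet_rel_trans P Q).

Definition same_block2 P Q : rel X :=
  fun x y => same_block P x y || same_block Q x y.

(* [connect] is reflexive on all of [X], hence the restriction to the union of
   the two underlying sets. *)
Definition join_rel P Q : rel X :=
  fun x y => same_block2 P Q x x && connect (same_block2 P Q) x y.

Lemma same_block2_sym P Q : symmetric (same_block2 P Q).
Proof.
by move=> x y; rewrite /same_block2 same_block_sym (same_block_sym Q).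
Qed.

Lemma same_block2_refl P Q x y : same_block2 P Q x y -> same_block2 P Q y y.
Proof.
rewrite /same_block2 => /orP[] h.
  by rewrite (same_block_trans _ h) // same_block_sym.
by rewrite orbC (same_block_trans _ h) // same_block_sym.
Qed.

Lemma join_rel_last P Q x y : join_rel P Q x y -> same_block2 P Q y y.
Proof.
case/andP=> xx /connectP[s + ->] {y}.
elim: s x xx => [//|y s ih] x xx /= /andP[xy]; apply: ih.
exact: same_block2_refl xy.
Qed.

Lemma join_rel_trans P Q : transitive (join_rel P Q).
Proof.
move=> y x z /andP[xx xy] /andP[yy yz].
by rewrite /join_rel xx (connect_trans xy yz).
Qed.

Lemma join_rel_sym P Q : symmetric (join_rel P Q).
Proof.
suff h x y : join_rel P Q x y -> join_rel P Q y x by move=> x y; apply/idP/idP; apply: h.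
move=> xy; rewrite /join_rel (join_rel_last xy) /=.
by rewrite (sym_connect_sym (same_block2_sym P Q)); case/andP: xy.
Qed.

Definition subpart_join P Q :=
  per_subpart (@join_rel_sym P Q) (@join_rel_trans P Q).

Fact subpart_display : Order.disp_t. Proof. exact: (Order.Disp tt tt). Qed.

Lemma subpart_le_refl : reflexive subpart_le.
Proof. by move=> P; apply/subpart_leP. Qed.

Lemma subpart_le_anti : antisymmetric subpart_le.
Proof.
move=> P Q /andP[/subpart_leP PQ /subpart_leP QP].
by apply: subpart_eqP => x y; apply/idP/idP => [/PQ|/QP].
Qed.

Lemma subpart_le_trans : transitive subpart_le.
Proof.
move=> Q P S /subpart_leP PQ /subpart_leP QS.
by apply/subpart_leP => x y /PQ/QS.
Qed.

HB.instance Definition _ := Order.Le_isPOrder.Build subpart_display subpart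
  subpart_le_refl subpart_le_anti subpart_le_trans.

Lemma subpart_meetP P Q S :
  (P <= subpart_meet Q S)%O = (P <= Q)%O && (P <= S)%O.
Proof.
apply/subpart_leP/andP => [h|[/subpart_leP PQ /subpart_leP PS] x y Pxy].
  by split; apply/subpart_leP => x y /h; rewrite same_block_per; case/andP.
by rewrite same_block_per /meet_rel PQ // PS.
Qed.

Lemma subpart_joinP P Q S :
  (subpart_join P Q <= S)%O = (P <= S)%O && (Q <= S)%O.
Proof.
apply/subpart_leP/andP => [h|[/subpart_leP PS /subpart_leP QS] x y].
  have h' x y : same_block2 P Q x y -> same_block S x y.
    move=> xy; apply: h; rewrite same_block_per /join_rel connect1 // andbT.
    by apply: (@same_block2_refl _ _ y); rewrite same_block2_sym.
  by split; apply/subpart_leP => x y xy; apply: h'; rewrite /same_block2 xy ?orbT.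
have h u v : same_block2 P Q u v -> same_block S u v.
  by case/orP => [/PS|/QS].
rewrite same_block_per; case/andP => /h Sxx /connectP[s + ->] {y}.
suff: forall z, same_block S x z -> path (same_block2 P Q) z s ->
  same_block S x (last z s) by exact.
elim: s => [z xz _ //|y s ih z xz /=].
by case/andP=> zy; apply: ih; apply: same_block_trans xz (h _ _ zy).
Qed.

HB.instance Definition _ := Order.POrder_MeetJoin_isLattice.Build
  subpart_display subpart subpart_meetP subpart_joinP.

Lemma eq_per_sym (D : {set X}) : symmetric (fun x y => (x \in D) && (y \in D)).
Proof. by move=> x y; rewrite andbC. Qed.

Lemma eq_per_trans (D : {set X}) : transitive (fun x y => (x \in D) && (y \in D)).
Proof. by move=> y x z /andP[-> _] /andP[_ ->]. Qed.

(* One block [D] (no block if [D] is empty). *)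
Definition block_subpart (D : {set X}) :=
  per_subpart (@eq_per_sym D) (@eq_per_trans D).

Lemma subpart_le0 P : (block_subpart set0 <= P)%O.
Proof. by apply/subpart_leP => x y; rewrite same_block_per inE. Qed.

Lemma subpart_le1 P : (P <= block_subpart setT)%O.
Proof. by apply/subpart_leP => x y; rewrite same_block_per !inE. Qed.

HB.instance Definition _ :=
  Order.hasBottom.Build subpart_display subpart subpart_le0.
HB.instance Definition _ :=
  Order.hasTop.Build subpart_display subpart subpart_le1.

Definition traces P (A : {set X}) : {set {set X}} :=
  [set B :&: A | B in (P : {set {set X}}) & B :&: A != set0].

Lemma traces_partition P (A : {set X}) :
  partition (traces P A) (cover (traces P A)).
Proof.
apply/and3P; split=> //; last first.
  by apply/imsetP => -[B]; rewrite inE => /andP[_ /[swap] <-]; rewrite eqxx.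
apply/trivIsetP => _ _ /imsetP[B + ->] /imsetP[C + ->].
rewrite !inE => /andP[PB _] /andP[PC _] BC.
apply/pred0P => x /=; rewrite !inE; apply/negP.
case/andP => /andP[xB _] /andP[xC _].
by move: BC; rewrite (block_uniq PB PC xB xC) eqxx.
Qed.

Definition restrict_subpart P A : subpart := SubPart (traces_partition P A).

(* The free abelian group on the power set of [X], which is finite. *)

Definition Zpow : Type := {ffun {set X} -> int}.

HB.instance Definition _ := GRing.Zmodule.on Zpow.

Definition Zpow_of P : Zpow := [ffun B => (B \in blocks_of P)%:R].

Definition total_coef (m : Zpow) : int := \sum_B m B.

End SubPart.

(* Required only here because [cover], [trivIset] and the set notations of
   [finset] are overridden by [classical_sets]. *)
From mathcomp Require Import all_classical all_reals all_analysis.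
Import numFieldNormedType.Exports.

Local Open Scope classical_set_scope.
Local Open Scope ring_scope.

Section Formigram.
Variables (R : realType) (X : finType).

Definition locally_finite (C : set R) : Prop :=
  forall t : R, exists2 U : set R, nbhs t U & finite_set (C `&` U).

Definition critical_points (theta : R -> subpart X) (C : set R) : Prop :=
  [/\ locally_finite C,
      forall s t, (~` C) s -> connected_component (~` C) s t ->
        theta t = theta s
    & forall c, C c -> exists2 r : R, 0 < r &
        forall e : R, 0 <= e < r ->
          (theta (c - e) <= theta c)%O /\ (theta (c + e) <= theta c)%O].

Definition lifespan (theta : R -> subpart X) (x : X) : set R :=
  [set t | x \in finset.cover (theta t)].

Record formigram := Formigram {
  formigram_fun :> R -> subpart X;
  formigram_critical : exists C, critical_points formigram_fun C;
  formigram_lifespan : forall x : X,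
    [/\ lifespan formigram_fun x !=set0, is_interval (lifespan formigram_fun x)
      & closed (lifespan formigram_fun x)] }.

Variable theta : formigram.

Definition formigram_support : set R := \bigcup_x lifespan theta x.

Definition saturated : Prop := forall x y, lifespan theta x = lifespan theta y.

Definition join_over (I : set R) : subpart X :=
  (\join_(P : subpart X | P \in [set theta t | t in I]) P)%O.

Definition meet_over (I : set R) : subpart X :=
  (\meet_(P : subpart X | P \in [set theta t | t in I]) P)%O.

Definition diamond (I : set R) : subpart X :=
  restrict_subpart (join_over I) (finset.cover (meet_over I)).

End Formigram.

(* As a left bound, [BSide true a] is "[a" and [BSide false a] is "(a"; as a
   right bound, [BSide true d] is "d)" and [BSide false d] is "d]". *)

Definition zset (R : realType) (i : interval int) : set R :=
  [set` map_itv (fun z : int => z%:~R : R) i].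

Arguments zset : clear implicits.

(* Nonemptiness is that of the real interval: (0, 1) is allowed. *)
Definition zitv (R : realType) : set (interval int) :=
  [set i | (exists b a c d, i = Interval (BSide b a) (BSide c d))
           /\ zset R i !=set0].

Arguments zitv : clear implicits.

Definition left_enlarge_bound (l : itv_bound int) : itv_bound int :=
  match l with
  | BSide false a => BSide true a
  | BSide true a => BSide false (a - 1)
  | BInfty b => BInfty int b
  end.

Definition right_enlarge_bound (u : itv_bound int) : itv_bound int :=
  match u with
  | BSide true d => BSide false d
  | BSide false d => BSide true (d + 1)
  | BInfty b => BInfty int b
  end.

Definition zitv_left (i : interval int) : interval int :=
  let: Interval l u := i in Interval (left_enlarge_bound l) u.

Definition zitv_right (i : interval int) : interval int :=
  let: Interval l u := i in Interval l (right_enlarge_bound u).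

Definition clustergram (R : realType) (X : finType) (theta : formigram R X)
    (i : interval int) : Zpow X :=
  Zpow_of (diamond theta (zset R i))
  - Zpow_of (diamond theta (zset R (zitv_right i)))
  - Zpow_of (diamond theta (zset R (zitv_left i)))
  + Zpow_of (diamond theta (zset R (zitv_left i) `|` zset R (zitv_right i))).

Definition silhouette (R : realType) (X : finType) (theta : formigram R X)
    (i : interval int) : int :=
  total_coef (clustergram theta i).

Section DirectSum.
Variables (F : fieldType) (K : Type).

Definition dprod (V : K -> lmodType F) : Type := forall k, V k.

Section Module.
Variable V : K -> lmodType F.

HB.instance Definition _ := Choice.copy (dprod V) (forall k, V k).

Implicit Types f g h : dprod V.

Definition dprod_add f g : dprod V := fun k => f k + g k.
Definition dprod_opp f : dprod V := fun k => - f k.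
Definition dprod_zero : dprod V := fun=> 0.
Definition dprod_scale (a : F) f : dprod V := fun k => a *: f k.

Fact dprod_addA : associative dprod_add.
Proof. by move=> f g h; apply: functional_extensionality_dep => k; apply: addrA. Qed.
Fact dprod_addC : commutative dprod_add.
Proof. by move=> f g; apply: functional_extensionality_dep => k; apply: addrC. Qed.
Fact dprod_add0 : left_id dprod_zero dprod_add.
Proof. by move=> f; apply: functional_extensionality_dep => k; apply: add0r. Qed.
Fact dprod_addN : left_inverse dprod_zero dprod_opp dprod_add.
Proof. by move=> f; apply: functional_extensionality_dep => k; apply: addNr. Qed.

HB.instance Definition _ := GRing.isZmodule.Build (dprod V)
  dprod_addA dprod_addC dprod_add0 dprod_addN.

Fact dprod_scaleA a b f : dprod_scale a (dprod_scale b f) = dprod_scale (a * b) f.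
Proof. by apply: functional_extensionality_dep => k; apply: scalerA. Qed.
Fact dprod_scale1 : left_id 1 dprod_scale.
Proof. by move=> f; apply: functional_extensionality_dep => k; apply: scale1r. Qed.
Fact dprod_scaleDr : right_distributive dprod_scale +%R.
Proof. by move=> a f g; apply: functional_extensionality_dep => k; apply: scalerDr. Qed.
Fact dprod_scaleDl f : {morph dprod_scale^~ f : a b / a + b}.
Proof. by move=> a b; apply: functional_extensionality_dep => k; apply: scalerDl. Qed.

HB.instance Definition _ := GRing.Zmodule_isLmodule.Build F (dprod V)
  dprod_scaleA dprod_scale1 dprod_scaleDr dprod_scaleDl.

Definition dsupport (f : dprod V) : set K := [set k | f k != 0].

Definition finsupp : {pred dprod V} := fun f => `[< finite_set (dsupport f) >].

Fact finsupp_submod : submod_closed finsupp.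
Proof.
split=> [|a f g /asboolP ff /asboolP fg]; apply/asboolP.
  suff -> : dsupport 0 = set0 by exact: finite_set0.
  by apply/seteqP; split=> k //=; rewrite /dsupport /= eqxx.
have : finite_set (dsupport f `|` dsupport g) by rewrite finite_setU.
apply: sub_finite_set => k; rewrite /dsupport /=.
rewrite -[(a *: f + g) k]/(a *: f k + g k).
by have [->|?] := eqVneq (f k) 0; [rewrite scaler0 add0r; right | left].
Qed.

HB.instance Definition _ := GRing.isSubmodClosed.Build F (dprod V) finsupp
  finsupp_submod.

Record dsum : Type := DSum { dsum_val :> dprod V; dsum_finsupp : dsum_val \in finsupp }.

HB.instance Definition _ := [isSub for dsum_val].
HB.instance Definition _ := [Choice of dsum by <:].
HB.instance Definition _ := [SubChoice_isSubLmodule of dsum by <:].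

End Module.

Section Map.
Variables (V W : K -> lmodType F) (f : forall k, {linear V k -> W k}).

Fact dsum_map_subproof (v : dsum V) :
  ((fun k => f k (dsum_val v k)) : dprod W) \in @finsupp W.
Proof.
apply/asboolP; have /asboolP := dsum_finsupp v.
apply: sub_finite_set => k; rewrite /dsupport /=.
by apply: contra_neq => ->; rewrite linear0.
Qed.

Definition dsum_map (v : dsum V) : dsum W := DSum (dsum_map_subproof v).

Fact dsum_map_linear : linear dsum_map.
Proof.
move=> a v w; apply: val_inj; apply: functional_extensionality_dep => k /=.
exact: linearP.
Qed.

HB.instance Definition _ :=
  GRing.isLinear.Build F (dsum V) (dsum W) _ dsum_map dsum_map_linear.

End Map.
End DirectSum.

Section PersistenceModule.
Variables (d : Order.disp_t) (P : porderType d) (F : fieldType).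
Local Open Scope order_scope.

Record pmod := PMod {
  pmod_space :> P -> lmodType F;
  pmod_map : forall p q, p <= q -> {linear pmod_space p -> pmod_space q};
  pmod_id : forall p (pp : p <= p) v, pmod_map pp v = v;
  pmod_comp : forall p q r (pq : p <= q) (qr : q <= r) (pr : p <= r) v,
    pmod_map pr v = pmod_map qr (pmod_map pq v) }.

Arguments pmod_map _ {p q} _.

Definition pmod_iso (M N : pmod) : Prop :=
  exists h : forall p, {linear M p -> N p},
    (forall p, bijective (h p)) /\
    (forall p q (pq : p <= q) v, h q (pmod_map M pq v) = pmod_map N pq (h p v)).

Section PModSum.
Variables (K : Type) (N : K -> pmod).

Definition pmod_sum_map p q (pq : p <= q) :
    {linear dsum (fun k => N k p) -> dsum (fun k => N k q)} :=
  dsum_map (fun k => pmod_map (N k) pq).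

Fact pmod_sum_id p (pp : p <= p) v : pmod_sum_map pp v = v.
Proof.
apply: val_inj; apply: functional_extensionality_dep => k; exact: pmod_id.
Qed.

Fact pmod_sum_comp p q r (pq : p <= q) (qr : q <= r) (pr : p <= r) v :
  pmod_sum_map pr v = pmod_sum_map qr (pmod_sum_map pq v).
Proof.
apply: val_inj; apply: functional_extensionality_dep => k; exact: pmod_comp.
Qed.

Definition pmod_sum : pmod := PMod pmod_sum_id pmod_sum_comp.

End PModSum.

Definition poset_convex (J : set P) : Prop :=
  forall p q r, J p -> J r -> p <= q -> q <= r -> J q.

Definition poset_connected (J : set P) : Prop :=
  forall p q, J p -> J q -> exists s : seq P,
    [/\ path >=<%O p s, last p s = q & forall r, r \in s -> J r].

Record poset_interval := PosetInterval {
  pitv_set :> set P;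
  pitv_nonempty : pitv_set !=set0;
  pitv_convex : poset_convex pitv_set;
  pitv_connected : poset_connected pitv_set }.

Section IntervalModule.
Variable J : poset_interval.

(* The subspace of [F] which is [F] on [J] and [0] elsewhere; [vsproj] is then
   the identity of [F] on [J] and zero elsewhere. *)
Definition ispace (p : P) : {vspace F^o} :=
  if `[< (J : set P) p >] then fullv else 0%VS.

Definition imodule_map p q (pq : p <= q) :
    {linear subvs_of (ispace p) -> subvs_of (ispace q)} :=
  vsproj (ispace q) \o vsval.

Fact imodule_id p (pp : p <= p) v : imodule_map pp v = v.
Proof. exact: vsvalK. Qed.

Lemma ispaceT p : (J : set P) p -> ispace p = fullv.
Proof. by move=> Jp; rewrite /ispace asboolT. Qed.

Lemma ispace0 p (v : subvs_of (ispace p)) : ~ (J : set P) p -> v = 0.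
Proof.
move=> Jp; have U0 : ispace p = 0%VS by rewrite /ispace asboolF.
by have := subvsP v; rewrite {2}U0 memv0 => /eqP v0; apply: val_inj.
Qed.

Fact imodule_comp p q r (pq : p <= q) (qr : q <= r) (pr : p <= r) v :
  imodule_map pr v = imodule_map qr (imodule_map pq v).
Proof.
rewrite /imodule_map /=; have [Jq|Jq] := pselect ((J : set P) q).
  by rewrite (vsprojK (U := ispace q)) // (ispaceT Jq) memvf.
have [Jp|Jp] := pselect ((J : set P) p); last first.
  by rewrite (ispace0 v Jp) !linear0.
have Jr : ~ (J : set P) r by move=> Jr; apply: Jq; exact: pitv_convex Jp Jr pq qr.
by rewrite [LHS]ispace0 // [RHS]ispace0.
Qed.

Definition interval_module : pmod :=
  @PMod (fun p => subvs_of (ispace p)) imodule_map imodule_id imodule_comp.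

End IntervalModule.

(* The multiset of intervals is given as a family indexed by an arbitrary
   type; multiplicities are cardinals of sets of indices. *)
Definition is_barcode (M : pmod) (K : Type) (J : K -> poset_interval) : Prop :=
  pmod_iso M (pmod_sum (fun k => interval_module (J k))).

End PersistenceModule.

Section Cint.
Variable R : realType.

Record cint := CInt { cint_ends :> R * R; cint_endsP : cint_ends.1 <= cint_ends.2 }.

HB.instance Definition _ := [isSub for cint_ends].
HB.instance Definition _ := [Choice of cint by <:].

Definition cint_set (I : cint) : set R := `[I.1, I.2].

Definition cint_le (I J : cint) : bool := (J.1 <= I.1) && (I.2 <= J.2).

Definition cint_lt (I J : cint) : bool := (J != I) && cint_le I J.

Fact cint_display : Order.disp_t. Proof. exact: (Order.Disp tt tt). Qed.

Fact cint_le_refl : reflexive cint_le.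
Proof. by move=> I; rewrite /cint_le !lexx. Qed.

Fact cint_le_anti : antisymmetric cint_le.
Proof.
move=> [[a b] ?] [[c e] ?] /andP[/andP[/= h1 h2] /andP[/= h3 h4]].
by apply: val_inj; congr (_, _); apply/le_anti/andP.
Qed.

Fact cint_le_trans : transitive cint_le.
Proof.
move=> J I L /andP[h1 h2] /andP[h3 h4].
by apply/andP; split; [exact: le_trans h3 h1 | exact: le_trans h2 h4].
Qed.

HB.instance Definition _ := Order.isPOrder.Build cint_display cint
  (fun I J => erefl (cint_lt I J)) cint_le_refl cint_le_anti cint_le_trans.

Lemma cint_leP (I J : cint) : (I <= J)%O <-> cint_set I `<=` cint_set J.
Proof.
rewrite /cint_set; split=> [/andP[h1 h2]|IJ].
  move=> t /=; rewrite !in_itv /= => /andP[u v].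
  by rewrite (le_trans h1 u) (le_trans v h2).
have I12 := cint_endsP I.
have /= := IJ I.1; rewrite !in_itv /= lexx I12 => /(_ isT)/andP[h1 _].
have /= := IJ I.2; rewrite !in_itv /= lexx I12 => /(_ isT)/andP[_ h2].
by apply/andP.
Qed.

Definition cint_point (t : R) : cint := @CInt (t, t) (lexx t).

Definition diagonal_slice (J : set cint) : set R := [set t | J (cint_point t)].

End Cint.

Section Blocks.
Variables (F : fieldType) (X : finType).

Definition block (P : subpart X) : finType := {B : {set X} | B \in blocks_of P}.

(* The linear extension of the map sending a block [B] of [P] to the block [C]
   of [Q] containing it, in coordinates with respect to the bases of blocks. *)
Definition block_push (P Q : subpart X) (f : {ffun block P -> F^o}) :
    {ffun block Q -> F^o} :=
  [ffun C : block Q => \sum_(B : block P | val B \subset val C) f B].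

Fact block_push_linear (P Q : subpart X) : linear (@block_push P Q).
Proof.
move=> a f g; apply/ffunP => C; rewrite !ffunE /= scaler_sumr -big_split /=.
by apply: eq_bigr => B _; rewrite !ffunE.
Qed.

HB.instance Definition _ (P Q : subpart X) := GRing.isLinear.Build F
  {ffun block P -> F^o} {ffun block Q -> F^o} _ (@block_push P Q)
  (@block_push_linear P Q).

Lemma block_sub_uniq (P : subpart X) (A : {set X}) (B C : block P) :
  A != finset.set0 -> A \subset val B -> A \subset val C -> B = C.
Proof.
case/finset.set0Pn=> x xA /fintype.subsetP/(_ _ xA) xB /fintype.subsetP/(_ _ xA) xC.
by apply: val_inj; apply: block_uniq xB xC; apply: valP.
Qed.

Lemma block_n0 (P : subpart X) (B : block P) : val B != finset.set0.
Proof. by apply/finset.set0Pn; apply: block_neq0 (valP B). Qed.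

Lemma block_push_id (P : subpart X) f : @block_push P P f = f.
Proof.
apply/ffunP => C; rewrite ffunE (big_pred1 C) // => B /=.
apply/idP/eqP => [BC|-> //].
exact: block_sub_uniq (block_n0 B) (subxx _) BC.
Qed.

Lemma block_push_comp (P Q S : subpart X) f : (P <= Q)%O -> (Q <= S)%O ->
  @block_push P S f = @block_push Q S (@block_push P Q f).
Proof.
move=> PQ QS; apply/ffunP => D; rewrite !ffunE.
under [RHS]eq_bigr => C _ do rewrite ffunE.
rewrite (exchange_big_dep xpredT) //= big_mkcond; apply: eq_bigr => B _.
have /exists_inP[C0 QC0 BC0] := forall_inP PQ _ (valP B).
pose C : block Q := exist _ C0 QC0.
have CE (C' : block Q) : (val B \subset val C') = (C' == C).
  apply/idP/eqP => [BC'|-> //].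
  exact: (block_sub_uniq (B := C') (C := C) (block_n0 B)).
under eq_bigl => C' do rewrite CE.
rewrite big_mkcondl big_pred1_eq.
suff -> : (val B \subset val D) = (val C \subset val D) by [].
have /exists_inP[D0 SD0 CD0] := forall_inP QS _ (valP C).
pose D' : block S := exist _ D0 SD0.
apply/idP/idP => [BD|]; last exact: fintype.subset_trans.
suff -> : D = D' by [].
exact: (block_sub_uniq (C := D') (block_n0 B) BD (fintype.subset_trans BC0 CD0)).
Qed.

Variables (R : realType) (theta : formigram R X).

Definition fmod_space (I : cint R) : lmodType F :=
  {ffun block (join_over theta (cint_set I)) -> F^o}.

Definition fmod_map (I J : cint R) (IJ : (I <= J)%O) :
    {linear fmod_space I -> fmod_space J} :=
  @block_push (join_over theta (cint_set I)) (join_over theta (cint_set J)).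

Fact fmod_id I (II : (I <= I)%O) v : fmod_map II v = v.
Proof. exact: block_push_id. Qed.

Lemma join_over_le (A B : set R) : A `<=` B ->
  (join_over theta A <= join_over theta B)%O.
Proof.
move=> AB; apply/joinsP => P /set_mem[t At <-].
by apply: joins_sup; apply/mem_set; exists t => //; apply: AB.
Qed.

Fact fmod_comp I J L (IJ : (I <= J)%O) (JL : (J <= L)%O) (IL : (I <= L)%O) v :
  fmod_map IL v = fmod_map JL (fmod_map IJ v).
Proof. by apply: block_push_comp; apply/join_over_le/cint_leP. Qed.

Definition formigram_module : pmod (cint R) F := PMod fmod_id fmod_comp.

End Blocks.

(* Main.v *)
(* Write [p k A] for the [k]-th coordinate of the given decomposition at the interval
   [A]. Inside the common lifespan every map of the module is onto, since every block is
   pushed from the block of any of its points; hence a summand containing [I] contains all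
   of its subintervals. Conversely, if a summand contains all the points of [I], then the
   coordinates of the elements of [X] agree along [I] and define a functional on the
   blocks of the join over [I], which detects the summand at [I]. So, for [I] in the
   lifespan, the bars containing [I] are exactly the summands alive at [I], and their
   number is the dimension at [I], namely the number of blocks of the join over [I], which
   is the diamond over [I]. For [I] not in the lifespan both numbers vanish.
   Inclusion-exclusion over [I] and its three enlargements gives the multiplicity. *)
From HB Require Import structures.
Require Import Defs.
From mathcomp Require Import all_boot all_order all_algebra.
From mathcomp Require Import all_classical all_reals all_analysis.
From mathcomp Require Import finmap zify.

Set Implicit Arguments.
Unset Strict Implicit.
Unset Printing Implicit Defensive.

Import Order.TTheory GRing.Theory Num.Theory.
Import numFieldNormedType.Exports.

Local Open Scope classical_set_scope.
Local Open Scope card_scope.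
Local Open Scope ring_scope.

(** * Cardinalities: inclusion-exclusion and dimension counts *)

(** Inclusion-exclusion on an arbitrary type: the sets are counted as finite sets over
    [{classic T}], and the alternating sum is taken in [int], where subtraction is not truncated. *)
Lemma card_setDU (T : Type) (S A B : set T) s a b c :
  A `<=` S -> B `<=` S -> S #= `I_s -> A #= `I_a -> B #= `I_b ->
  A `&` B #= `I_c ->
  exists2 m : nat, S `\` (A `|` B) #= `I_m
    & s%:Z - a%:Z - b%:Z + c%:Z = m%:Z.
Proof.
move=> AS BS Ss Aa Bb ABc.
have fin (E : set T) n : E #= `I_n -> finite_set E.
  by move=> ?; apply/finite_setP; exists n.
have fS := fin _ _ Ss; have fA := fin _ _ Aa; have fB := fin _ _ Bb.
have /finite_setP[m Dm] : finite_set (S `\` (A `|` B)) by exact: finite_setD.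
exists m => //.
pose fs (E : set T) := fset_set (E : set {classic T}).
have cS : #|` fs S| = s := card_fset_set (Ss : (S : set {classic T}) #= _).
have cA : #|` fs A| = a := card_fset_set (Aa : (A : set {classic T}) #= _).
have cB : #|` fs B| = b := card_fset_set (Bb : (B : set {classic T}) #= _).
have cAB : #|` fs (A `&` B)| = c :=
  card_fset_set (ABc : (A `&` B : set {classic T}) #= _).
have cD : #|` fs (S `\` (A `|` B))| = m :=
  card_fset_set (Dm : (S `\` (A `|` B) : set {classic T}) #= _).
have UE : fs (A `|` B) = (fs A `|` fs B)%fset by exact: fset_setU.
have IE : fs (A `&` B) = (fs A `&` fs B)%fset by exact: fset_setI.
have DE : fs (S `\` (A `|` B)) = (fs S `\` fs (A `|` B)%classic)%fset.
  by apply: fset_setD => //; rewrite finite_setU.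
have US : (fs (A `|` B)%classic `<=` fs S)%fset.
  rewrite UE fsubUset; apply/andP.
  by split; apply/fsubsetP => x; rewrite !in_fset_set // => /set_mem h; apply/mem_set;
    [exact: AS|exact: BS].
have := cardfsID (fs (A `|` B)) (fs S); rewrite -DE cD cS (fsetIidPr US).
have := cardfsUI (fs A) (fs B); rewrite -UE -IE cA cB cAB.
lia.
Qed.

Lemma leq_card_ffun (F : fieldType) (S T : finType)
    (f : {linear {ffun S -> F^o} -> {ffun T -> F^o}}) :
  injective f -> (#|S| <= #|T|)%N.
Proof.
move=> f_inj; have lf_inj : injective (linfun f).
  by move=> u v; rewrite !lfunE => /f_inj.
have /lker0P/eqP ker0 := lf_inj.
have := dimvS (subvf (limg (linfun f))).
rewrite limg_dim_eq ?ker0 ?capv0 // !dimvf /dim /=.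
by rewrite !muln1.
Qed.

Section FiniteFunctions.
Variables (F : fieldType) (T : finType).

(** The dual vectors over any finite part of [S] are independent, which bounds its size by [#|T|]
    and forces [S] to be finite. Conversely, the coordinates in [S] separate vectors, so the whole
    space embeds in the functions on [S]. *)
Lemma card_dual_family (K : Type) (S : set K)
    (p : K -> {linear {ffun T -> F^o} -> F^o}) :
  (forall k, S k -> exists v, p k v = 1 /\ forall j, j <> k -> p j v = 0) ->
  (forall v, (forall k, S k -> p k v = 0) -> v = 0) ->
  S #= `I_#|T|.
Proof.
move=> dual sep.
have /choice[v vP] : forall k, exists v, S k ->
    p k v = 1 /\ forall j, j <> k -> p j v = 0.
  move=> k; have [/dual[v ?]|nSk] := pselect (S k); first by exists v.
  by exists 0.
have le_fset (B : {fset {classic K}}) : [set` B] `<=` S -> (#|` B| <= #|T|)%N.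
  move=> BS; pose f (c : {ffun B -> F^o}) := \sum_(b : B) c b *: v (val b).
  have f_lin : linear f.
    move=> a c d; rewrite /f scaler_sumr -big_split /=; apply: eq_bigr => b _.
    by rewrite !ffunE scalerDl scalerA.
  pose fM := GRing.isLinear.Build F _ _ _ f f_lin.
  pose fL : {linear {ffun B -> F^o} -> {ffun T -> F^o}} := HB.pack f fM.
  have pf c (b : B) : p (val b) (f c) = c b.
    have Sb (b' : B) : S (val b') by apply: BS; exact: valP.
    rewrite /f linear_sum (bigD1 b) //= linearZ /= (vP _ (Sb b)).1.
    rewrite big1 ?addr0 ?[_ *: _]mulr1 // => b' b'b; rewrite linearZ /=.
    rewrite (vP _ (Sb b')).2 ?scaler0 // => bb'.
    by move/eqP: b'b; apply; apply: val_inj; exact: esym bb'.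
  rewrite cardfE; apply: (@leq_card_ffun F _ _ fL) => c d /= fcd.
  by apply/ffunP => b; rewrite -!pf fcd.
(* An infinite [S] would contain a finite part with more than [#|T|] elements. *)
have finS : finite_set S.
  apply: contrapT => infS.
  have [B BS] := @infinite_set_fset {classic K} S #|T|.+1 infS.
  by rewrite ltnNge le_fset.
pose B := fset_set (S : set {classic K}).
have BE : [set` B] = S by rewrite fset_setK.
suff cB : #|` B| = #|T| by rewrite -BE; exact/(@card_eq_fsetP {classic K}).
apply/eqP; rewrite eqn_leq le_fset ?BE //=.
pose g (u : {ffun T -> F^o}) : {ffun B -> F^o} := [ffun b : B => p (val b) u].
have g_lin : linear g by move=> a c d; apply/ffunP => b; rewrite !ffunE linearP.
pose gM := GRing.isLinear.Build F _ _ _ g g_lin.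
pose gL : {linear {ffun T -> F^o} -> {ffun B -> F^o}} := HB.pack g gM.
rewrite cardfE; apply: (@leq_card_ffun F _ _ gL) => c d /= gcd.
apply/eqP; rewrite -subr_eq0; apply/eqP/sep => k Sk.
have kB : (k : {classic K}) \in B by rewrite /B in_fset_set //; exact/mem_set.
have := congr1 (fun h : {ffun B -> F^o} => h [` kB]%fset) gcd.
by rewrite /g !ffunE /= linearB /= => ->; rewrite subrr.
Qed.

End FiniteFunctions.

(** * Vectors and functionals on the blocks of a subpartition *)

Section BlockVectors.
Variables (F : fieldType) (X : finType).
Implicit Types (P Q : subpart X) (x y : X).

(** The basis vector of the block of [x], or zero when no block contains [x]. *)
Definition point_vec P x : {ffun block P -> F^o} :=
  [ffun B : block P => (x \in val B)%:R].

Lemma block_cover P x : x \in finset.cover P -> exists B : block P, x \in val B.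
Proof. by case/bigcupP => B PB xB; exists (exist _ B PB). Qed.

Lemma val_block_cover P (B : block P) x : x \in val B -> x \in finset.cover P.
Proof. by move=> xB; apply/bigcupP; exists (val B) => //; exact: valP. Qed.

Lemma block_eq P (B C : block P) x : x \in val B -> x \in val C -> B = C.
Proof. by move=> xB xC; apply/val_inj/(block_uniq (valP B) (valP C) xB xC). Qed.

Lemma point_vec_same P x y : same_block P x y -> point_vec P x = point_vec P y.
Proof.
case/same_blockP => B [PB xB yB]; apply/ffunP => C; rewrite !ffunE; congr (_%:R).
have cE z : z \in B -> (z \in val C) = (C == exist _ B PB).
  by move=> zB; apply/idP/eqP => [zC|-> //]; exact: (block_eq (C := exist _ B PB) zC).
by rewrite !cE.
Qed.

(** Only the block of [x] contributes to the sum, and a block of [Q] contains it as soon as it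
    contains [x]. *)
Lemma block_push_point P Q x : (P <= Q)%O -> x \in finset.cover P ->
  block_push Q (point_vec P x) = point_vec Q x.
Proof.
move=> PQ /block_cover[B xB]; apply/ffunP => C; rewrite !ffunE.
have BC : (val B \subset val C) = (x \in val C).
  apply/idP/idP => [/fintype.subsetP|xC]; first exact.
  have /exists_inP[C0 QC0 BC0] := forall_inP PQ _ (valP B).
  suff -> : val C = C0 by [].
  exact: block_uniq (valP C) QC0 xC (fintype.subsetP BC0 _ xB).
rewrite -BC big_mkcond (bigD1 B) //= -[RHS]addr0; congr (_ + _).
  by rewrite ffunE xB; case: ifP.
apply: big1 => B' B'B; case: ifP => // _; rewrite ffunE.
case: (boolP (x \in val B')) => // xB'.
by rewrite (block_eq xB' xB) eqxx in B'B.
Qed.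

(** Blocks are nonempty, so every basis vector is the vector of a point. *)
Lemma linear_point_ext P (f g : {linear {ffun block P -> F^o} -> F^o}) :
  (forall x, x \in finset.cover P -> f (point_vec P x) = g (point_vec P x)) ->
  f =1 g.
Proof.
move=> fg v.
have xs (B : block P) : exists x, x \in val B by exact: block_neq0 (valP B).
have -> : v = \sum_B v B *: point_vec P (xchoose (xs B)).
  apply/ffunP => C; rewrite sum_ffunE (bigD1 C) //= !ffunE (xchooseP (xs C)).
  rewrite big1 ?addr0 ?[_ *: _]mulr1 // => B BC; rewrite !ffunE.
  case: (boolP (_ \in val C)) => [h|_]; last by rewrite scaler0.
  by rewrite (block_eq (xchooseP (xs B)) h) eqxx in BC.
rewrite !linear_sum; apply: eq_bigr => B _; rewrite !linearZ /= fg //.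
exact: val_block_cover (xchooseP (xs B)).
Qed.

(** The functional weights each block by the value of [phi] at a chosen point; invariance makes the
    choice immaterial. *)
Lemma linear_of_invariant P (phi : X -> F) :
  (forall x y, same_block P x y -> phi x = phi y) ->
  exists f : {linear {ffun block P -> F^o} -> F^o},
    forall x, x \in finset.cover P -> f (point_vec P x) = phi x.
Proof.
move=> phiP.
have xs (B : block P) : exists x, x \in val B by exact: block_neq0 (valP B).
pose f (v : {ffun block P -> F^o}) : F^o := \sum_B v B * phi (xchoose (xs B)).
have f_lin : linear f.
  move=> a c d; rewrite /f scaler_sumr -big_split /=; apply: eq_bigr => b _.
  by rewrite !ffunE mulrDl; congr (_ + _); exact: esym (mulrA a _ _).
pose fM := GRing.isLinear.Build F _ _ _ f f_lin.
pose fL : {linear {ffun block P -> F^o} -> F^o} := HB.pack f fM.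
exists fL => x /block_cover[B xB]; rewrite /= /f (bigD1 B) //= big1 => [|C CB].
  rewrite ffunE xB mul1r addr0; apply: phiP; apply/same_blockP.
  by exists (val B); split=> //; [exact: valP|exact: xchooseP].
rewrite ffunE; case: (boolP (x \in val C)) => [xC|_]; last by rewrite mul0r.
by rewrite (block_eq xC xB) eqxx in CB.
Qed.

Lemma block_push_inj P Q : P = Q ->
  injective (block_push Q : {ffun block P -> F^o} -> {ffun block Q -> F^o}).
Proof. by move=> -> u v; rewrite !block_push_id. Qed.

End BlockVectors.

(** * Coordinates of a barcode decomposition *)

(** [p k A] is the isomorphism followed by the projection to the [k]-th summand, read in [F].
    Testing [B] alone is enough in the first clause: if [A] is outside the interval, [p k A] is
    already zero. *)
Lemma barcode_functionals (d : Order.disp_t) (P : porderType d) (F : fieldType)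
    (M : pmod P F) (K : Type) (J : K -> poset_interval P) :
  is_barcode M J ->
  exists p : K -> forall A : P, {linear M A -> F^o},
    [/\ forall k A B (AB : (A <= B)%O) v,
          p k B (pmod_map M AB v) = if `[< pitv_set (J k) B >] then p k A v else 0,
        forall k A, pitv_set (J k) A ->
          exists v, p k A v = 1 /\ forall j, j <> k -> p j A v = 0
      & forall A v, (forall k, p k A v = 0) -> v = 0].
Proof.
move=> [h [h_bij h_nat]].
pose f k A (v : M A) : F^o := vsval (dsum_val (h A v) k).
have f_lin k A : linear (f k A) by move=> a u v; rewrite /f linearP /= -linearP.
pose fL k A : {linear M A -> F^o} :=
  let fM := GRing.isLinear.Build F (M A) F^o _ (f k A) (f_lin k A) in
  HB.pack (f k A) fM.
exists fL; split=> [k A B AB v|k A JA|A v v0].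
- rewrite /= /f h_nat /=; case: asboolP => JB; last by rewrite [vsproj _ _]ispace0.
  by rewrite vsprojK // (ispaceT F JB) memvf.
(* The family with entry 1 at [k] and 0 elsewhere, pulled back through the isomorphism. *)
- pose w : dprod (fun j => subvs_of (ispace F (J j) A)) :=
    fun j => vsproj _ (`[< j = k >]%:R : F^o).
  have w_fin : w \in @Defs.finsupp _ _ _.
    apply/asboolP; apply: (@sub_finite_set _ _ [set k]) (finite_set1 _) => j.
    by rewrite /dsupport /= /w; case: asboolP => // _; rewrite linear0 eqxx.
  have [g _ hK] := h_bij A.
  exists (g (DSum w_fin)); rewrite /= /f hK /= /w; split=> [|j jk].
    by rewrite asboolT // vsprojK // (ispaceT F JA) memvf.
  by rewrite asboolF // linear0.
- apply: (bij_inj (h_bij A)); rewrite linear0; apply: val_inj.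
  by apply: functional_extensionality_dep => k; apply: val_inj; exact: v0.
Qed.

Lemma linear_point_neq0 (F : fieldType) (X : finType) (P : subpart X)
    (f : {linear {ffun block P -> F^o} -> F^o}) v :
  f v != 0 ->
  exists2 x, x \in finset.cover P & f (point_vec F P x) != 0.
Proof.
move=> fv; apply: contrapT => f0; case/eqP: fv.
apply: (linear_point_ext (g := \0 : {linear {ffun block P -> F^o} -> F^o})) => x Px.
by apply/eqP/negPn/negP => fx; apply: f0; exists x.
Qed.

(** * Joins and meets of a formigram over a set of times *)

Lemma cover_le (X : finType) (P Q : subpart X) x :
  (P <= Q)%O -> x \in finset.cover P -> x \in finset.cover Q.
Proof. by move=> /subpart_leP PQ; rewrite -!same_block_cover => /PQ. Qed.

Section Joins.
Variables (R : realType) (X : finType) (theta : formigram R X).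
Implicit Types (I : set R) (t : R) (x : X).

Lemma le_join_over I t : I t -> (theta t <= join_over theta I)%O.
Proof. by move=> It; apply: joins_sup; apply/mem_set; exists t. Qed.

Lemma join_over_lub I Q :
  (forall t, I t -> (theta t <= Q)%O) -> (join_over theta I <= Q)%O.
Proof. by move=> IQ; apply/joinsP => _ /set_mem[t /IQ ? <-]. Qed.

Lemma meet_over_glb I Q :
  (forall t, I t -> (Q <= theta t)%O) -> (Q <= meet_over theta I)%O.
Proof. by move=> IQ; apply/meetsP => _ /set_mem[t /IQ ? <-]. Qed.

Lemma meet_over_le I t : I t -> (meet_over theta I <= theta t)%O.
Proof. by move=> It; apply: meets_inf; apply/mem_set; exists t. Qed.

(** The union of the underlying sets, taken as a single block, is an upper bound and hence lies
    above the join. *)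
Lemma join_over_cover I x : x \in finset.cover (join_over theta I) ->
  exists2 t, I t & x \in finset.cover (theta t).
Proof.
pose U : {set X} := [set x | `[< exists2 t, I t & x \in finset.cover (theta t) >]]%SET.
have le_U : (join_over theta I <= block_subpart U)%O.
  apply: join_over_lub => t It; apply/subpart_leP => y z yz.
  rewrite same_block_per !inE; apply/andP; split; apply/asboolP; exists t => //.
    by rewrite -same_block_cover (same_block_trans yz) // same_block_sym.
  by rewrite -same_block_cover (same_block_trans _ yz) // same_block_sym.
move=> /(cover_le le_U); rewrite -same_block_cover same_block_per andbb inE.
by move/asboolP.
Qed.

End Joins.

(** * Cells of the line cut at the integers *)

Section Cells.
Variable R : realType.
Implicit Types (s t : R) (m n p q : int).

(* Numbers the cells of the subdivision of the line at the integers: the point [{n}]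
   has number [2n] and the open interval [(n, n+1)] has number [2n+1]. *)
Definition cell t : int := Num.floor t + Num.ceil t.

(** A representative of cell [m]: the integer itself for even [m], the midpoint of the open unit
    interval for odd [m]. *)
Definition cell_mid m : R := m%:~R / 2.

Definition cell_range p q : set R := [set t | p <= cell t <= q].

Lemma floor_ceil t :
  (Num.floor t <= Num.ceil t) && (Num.ceil t <= Num.floor t + 1).
Proof. by rewrite ceil_floor; case: (t \isn't a _); rewrite ?addr0 lexx lerDl. Qed.

Lemma cell_mono s t : s <= t -> cell s <= cell t.
Proof. by move=> st; rewrite lerD // ?le_floor ?le_ceil. Qed.

Lemma cell_midK m : cell (cell_mid m) = m.
Proof.
rewrite /cell; have := floor_itv (cell_mid m); have := ceil_itv (cell_mid m).
move: (Num.floor _) (Num.ceil _) => f c.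
rewrite /cell_mid ltr_pdivlMr // ler_pdivrMr // ler_pdivlMr // ltr_pdivrMr //.
rewrite -[2]/(2%:~R) -!intrM !ler_int !ltr_int; lia.
Qed.

Lemma cell_mid_le p q : p <= q -> cell_mid p <= cell_mid q.
Proof. by move=> pq; rewrite ler_pM2r ?invr_gt0 // ler_int. Qed.

(** Ceiling minus floor is 0 or 1, so the parity of their sum recovers both. *)
Lemma cell_eq s t : cell s = cell t ->
  s = t \/ exists n, n%:~R < s < (n + 1)%:~R /\ n%:~R < t < (n + 1)%:~R.
Proof.
rewrite /cell => st; have := floor_ceil s; have := floor_ceil t => ct cs.
have fE : Num.floor s = Num.floor t by lia.
have cE : Num.ceil s = Num.ceil t by lia.
have [s1 s2] := (floor_le s, ceil_ge s); have [t1 t2] := (floor_le t, ceil_ge t).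
rewrite fE cE in s1 s2.
have [fc|fc] := eqVneq (Num.floor t) (Num.ceil t).
  left; rewrite fc in s1 t1; apply/le_anti/andP.
  by split; [exact: le_trans s2 t1|exact: le_trans t2 s1].
right; exists (Num.floor t).
have lt_ceil : Num.floor t < Num.ceil t by lia.
have lt_floor : Num.ceil t < Num.floor t + 2 by lia.
rewrite !floorD1_gt -{2}fE floorD1_gt !andbT -!ceil_gt_int cE.
by split.
Qed.

(** A closed end at an integer includes its even-numbered cell; an open end stops one cell short of
    it. The flag [true] means closed on the left but open on the right. *)
Lemma zset_cell_range b a c d : let i := Interval (BSide b a) (BSide c d) in
  zset R i = cell_range (2 * a + (~~ b)%:Z) (2 * d - c%:Z).
Proof.
move=> /=; apply/seteqP; have E t : (t \in map_itv (fun z : int => z%:~R : R)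
    (Interval (BSide b a) (BSide c d))) =
    (2 * a + (~~ b)%:Z <= cell t <= 2 * d - c%:Z).
  rewrite itv_boundlr /= /cell; have := floor_ceil t => fc.
  congr (_ && _).
  - case: b; rewrite /= bnd_simp -?floor_ge_int -?ceil_gt_int;
      move: (Num.floor t) (Num.ceil t) fc => f c'; lia.
  - case: c; rewrite /= bnd_simp -?floor_lt_int -?ceil_le_int;
      move: (Num.floor t) (Num.ceil t) fc => f c'; lia.
by split=> t; rewrite /zset /cell_range /= E.
Qed.

End Cells.

(** * Betweenness with endpoints in either order, and closed intervals *)

Definition between (R : realType) (a b u : R) : bool :=
  (a <= u <= b) || (b <= u <= a).

Lemma between_l (R : realType) (a b : R) : between a b a.
Proof. by rewrite /between !lexx andbT /=; exact: le_total. Qed.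

Lemma between_r (R : realType) (a b : R) : between a b b.
Proof. by rewrite /between !lexx andbT /=; exact: le_total. Qed.

Lemma between_split (R : realType) (a b c u : R) :
  between a b u -> between a c u || between c b u.
Proof.
rewrite /between; have [uc|/ltW cu] := leP u c.
  by case/orP => /andP[-> _]; rewrite ?orbT.
by case/orP => /andP[_ ->]; rewrite cu ?orbT.
Qed.

Lemma between_itv (R : realType) (E : set R) a b u :
  is_interval E -> E a -> E b -> between a b u -> E u.
Proof. by move=> iE Ea Eb /orP[] h; [exact: iE Ea Eb _ h|exact: iE Eb Ea _ h]. Qed.

Lemma cint_set_itv (R : realType) (A : cint R) : is_interval (cint_set A).
Proof. exact: interval_is_interval. Qed.

Lemma cint_point_set (R : realType) (t u : R) : cint_set (cint_point t) u -> u = t.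
Proof. by rewrite /cint_set /= in_itv /= => h; apply/le_anti; rewrite andbC. Qed.

Lemma cint_point_le (R : realType) (A : cint R) t :
  cint_set A t -> (cint_point t <= A)%O.
Proof. by move=> At; apply/cint_leP => u /cint_point_set ->. Qed.

(** * Summands and the points of their bars *)

Section Components.
Variables (R : realType) (F : fieldType) (X : finType) (theta : formigram R X).
Variables (K : Type) (J : K -> poset_interval (cint R)).
Hypothesis theta_sat : saturated theta.
Variable p : K -> forall A : cint R, {linear fmod_space F theta A -> F^o}.
Hypothesis p_push : forall k (A B : cint R) (AB : (A <= B)%O) v,
  p k B (fmod_map F theta AB v) = if `[< pitv_set (J k) B >] then p k A v else 0.
Hypothesis p_dual : forall k A, pitv_set (J k) A ->
  exists v, p k A v = 1 /\ forall j, j <> k -> p j A v = 0.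
Hypothesis p_sep : forall A v, (forall k, p k A v = 0) -> v = 0.

Implicit Types (k : K) (A B I : cint R) (s t u : R) (x y : X).

Local Notation joinc A := (join_over theta (cint_set A)).
Local Notation live t := (exists x, x \in finset.cover (theta t)).
Local Notation Jk k A := (pitv_set (J k) A).

Lemma live_cover t x : live t -> x \in finset.cover (theta t).
Proof. by case=> y yt; have : lifespan theta y t := yt; rewrite (theta_sat y x). Qed.

Lemma live_between s t u : live s -> live t -> between s t u -> live u.
Proof.
move=> [x xs] lt stu; exists x; have [_ iL _] := formigram_lifespan theta x.
exact: (between_itv iL xs (live_cover x lt) stu).
Qed.

Lemma cover_joinc A t x : cint_set A t -> live t -> x \in finset.cover (joinc A).
Proof. by move=> At lt; exact: cover_le (le_join_over theta At) (live_cover x lt). Qed.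

Definition point_coef k A x : F^o := p k A (point_vec F (joinc A) x).

Lemma point_coef_push k A B x : (A <= B)%O -> x \in finset.cover (joinc A) ->
  point_coef k B x = if `[< Jk k B >] then point_coef k A x else 0.
Proof.
move=> AB xA; rewrite -(p_push k AB) /point_coef /fmod_map /= block_push_point //.
by apply/join_over_le/cint_leP.
Qed.

(** Pushing along the identity of [A] gives 0 when [A] is outside the summand. *)
Lemma coef_support k A v : p k A v != 0 -> Jk k A.
Proof.
rewrite -{1}[v](fmod_id (lexx A)) p_push; case: asboolP => //.
by rewrite eqxx.
Qed.

Lemma point_coef_neq0 k A : Jk k A ->
  exists2 x, x \in finset.cover (joinc A) & point_coef k A x != 0.
Proof.
by case/p_dual => v [v1 _]; apply: (@linear_point_neq0 _ _ _ _ v); rewrite v1 oner_eq0.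
Qed.

(** Some element of [X] has a nonzero coefficient at [A]. It lies in a block at some time [t] of
    [A], and its coefficient at [A] is pushed from the one at [t]. *)
Lemma interval_has_point k A : Jk k A ->
  exists t, [/\ cint_set A t, Jk k (cint_point t) & live t].
Proof.
move=> JA; have [x /join_over_cover[t At xt] ex] := point_coef_neq0 JA.
have lt : live t by exists x.
exists t; split=> //; apply: (coef_support (v := point_vec F _ x)).
move: ex; rewrite (point_coef_push _ (cint_point_le At)) ?asboolT //.
by apply: (cover_joinc _ _ lt); rewrite /cint_set /= in_itv /= lexx.
Qed.

Lemma point_live k t : Jk k (cint_point t) -> live t.
Proof. by case/interval_has_point => u [/cint_point_set -> _]. Qed.

Lemma cint_nonempty A : cint_set A A.1.
Proof. by rewrite /cint_set /= in_itv /= lexx cint_endsP. Qed.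

Lemma cint_point_mem t : cint_set (cint_point t) t.
Proof. by rewrite /cint_set /= in_itv /= lexx. Qed.

(* [block_push] is onto between intervals inside the lifespan. *)
Lemma interval_down_closed k A I : (forall t, cint_set I t -> live t) ->
  (A <= I)%O -> Jk k I -> Jk k A.
Proof.
move=> lI AI JI; have [x _ ex] := point_coef_neq0 JI.
apply: (coef_support (v := point_vec F _ x)).
move: ex; rewrite (point_coef_push _ AI) ?asboolT //.
apply: (cover_joinc _ (cint_nonempty A)); apply: lI.
by have /cint_leP := AI; apply; exact: cint_nonempty.
Qed.

Lemma min_le_max s t : Num.min s t <= Num.max s t.
Proof. by case: (leP s t) => // /ltW. Qed.

Definition hull s t : cint R := @CInt R (Num.min s t, Num.max s t) (min_le_max s t).

Lemma hullP s t u : reflect (cint_set (hull s t) u) (between s t u).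
Proof.
apply: (iffP idP); rewrite /cint_set /between /= in_itv /=; case: (leP s t) => //.
- by move=> st; case/orP => // /andP[tu us]; rewrite (le_trans st tu) (le_trans us st).
- by move=> /ltW ts; case/orP => // /andP[su ut];
    rewrite (le_trans ts su) (le_trans ut ts).
- by move=> _ ->.
- by move=> _ ->; rewrite orbT.
Qed.

Lemma hull_le A s t : cint_set A s -> cint_set A t -> (hull s t <= A)%O.
Proof.
move=> As At; apply/cint_leP => u /hullP.
exact: between_itv (@cint_set_itv _ A) As At.
Qed.

(** [A] may leave the lifespan, so down-closure does not apply to it directly. The hull of [t] and a
    live point of the summand in [A] stays in the lifespan and belongs to the summand by
    convexity. *)
Lemma interval_points k A t : Jk k A -> cint_set A t -> live t ->
  Jk k (cint_point t).
Proof.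
move=> JA At lt; have [s [As Js ls]] := interval_has_point JA.
have hs : cint_set (hull s t) s by apply/hullP; exact: between_l.
have ht : cint_set (hull s t) t by apply/hullP; exact: between_r.
apply: (interval_down_closed (I := hull s t)).
- by move=> u /hullP; exact: live_between ls lt.
- exact: cint_point_le.
- exact: (pitv_convex Js JA (cint_point_le hs) (hull_le As At)).
Qed.

Lemma point_coef_const k A t x : Jk k A -> cint_set A t -> live t ->
  point_coef k (cint_point t) x = point_coef k A x.
Proof.
move=> JA At lt; rewrite (point_coef_push _ (cint_point_le At)) ?asboolT //.
exact: cover_joinc (cint_point_mem t) lt.
Qed.

(* Consecutive members of a connecting path share a live point of the bar, so the
   live parts of the members of the path chain up to cover everything in between. *)
Lemma path_points k A (s : seq (cint R)) a b u : Jk k A -> path >=<%O A s ->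
  (forall B, B \in s -> Jk k B) ->
  cint_set A a -> live a -> cint_set (last A s) b -> live b -> between a b u ->
  Jk k (cint_point u) /\
  forall x, point_coef k (cint_point u) x = point_coef k (cint_point a) x.
Proof.
have in_A A' a' b' : Jk k A' -> cint_set A' a' -> live a' -> cint_set A' b' ->
    live b' -> between a' b' u -> Jk k (cint_point u) /\
    forall x, point_coef k (cint_point u) x = point_coef k (cint_point a') x.
  move=> JA Aa la Ab lb abu; have lu := live_between la lb abu.
  have Au := between_itv (@cint_set_itv _ A') Aa Ab abu.
  split=> [|x]; first exact: interval_points JA Au lu.
  by rewrite !(point_coef_const _ JA).
elim: s A a => [|B s ih] A a JA /=; first by move=> _ _; exact: in_A.
case/andP => AB Bs Js Aa la sb lb abu.
have JB : Jk k B by apply: Js; rewrite inE eqxx.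
have [c [Ac Bc lc]] : exists c, [/\ cint_set A c, cint_set B c & live c].
  case/orP: AB => /cint_leP AB.
    have [c [Ac _ lc]] := interval_has_point JA.
    by exists c; split=> //; exact: AB.
  have [c [Bc _ lc]] := interval_has_point JB.
  by exists c; split=> //; exact: AB.
have {abu} /orP[acu|cbu] := between_split c abu; first exact: (in_A A a c).
have Js' C : C \in s -> Jk k C by move=> sC; apply: Js; rewrite inE sC orbT.
have [Ju uc] := ih _ _ JB Bs Js' Bc lc sb lb cbu.
by split=> // x; rewrite uc !(point_coef_const _ JA).
Qed.

Lemma bar_points k a b u :
  Jk k (cint_point a) -> Jk k (cint_point b) -> between a b u ->
  Jk k (cint_point u) /\
  forall x, point_coef k (cint_point u) x = point_coef k (cint_point a) x.
Proof.
move=> Ja Jb; have [s [ps sb Js]] := pitv_connected Ja Jb.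
apply: (path_points Ja ps Js) => //; [exact: cint_point_mem|exact: point_live Ja| |].
  by rewrite sb; exact: cint_point_mem.
exact: point_live Jb.
Qed.

(* The coefficients of the points of [X] in the [k]-th summand are the same over all
   of [I], so they induce a functional on the blocks of [joinc I]. *)
Lemma interval_of_points k I :
  (forall t, cint_set I t -> Jk k (cint_point t)) -> Jk k I.
Proof.
move=> JI; apply: contrapT => nJI.
pose s := I.1; have Is : cint_set I s := cint_nonempty I.
pose phi := point_coef k (cint_point s).
have phiE t x : cint_set I t -> point_coef k (cint_point t) x = phi x.
  by move=> It; have [_ ->] := bar_points (JI _ Is) (JI _ It) (between_r s t).
have phi_inv x y : same_block (joinc I) x y -> phi x = phi y.
  (* The fibres of [phi] form a subpartition above every [theta t] with [t] in [I], hence above the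
     join. *)
  pose e : rel X := fun x' y' => phi x' == phi y'.
  have es : symmetric e by move=> ? ?; rewrite /e eq_sym.
  have et : transitive e by move=> ? ? ?; rewrite /e => /eqP-> /eqP->.
  suff /subpart_leP h : (joinc I <= per_subpart es et)%O.
    by move/h; rewrite same_block_per => /eqP.
  apply: join_over_lub => t It; apply/subpart_leP => y' z yz.
  rewrite same_block_per /e -!(phiE t) //; apply/eqP; congr (p k _ _).
  apply: point_vec_same; have /subpart_leP := le_join_over theta (cint_point_mem t).
  exact.
have [f fE] := linear_of_invariant phi_inv.
have sI := cint_point_le Is.
have [v [v1 v0]] := p_dual (JI _ Is).
have fp : f \o fmod_map F theta sI =1 p k (cint_point s).
  apply: linear_point_ext => x xs /=.
  rewrite block_push_point //; last exact/join_over_le/cint_leP.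
  by rewrite fE // (cover_joinc _ Is) //; exact: point_live (JI _ Is).
(* The dual vector of [k] at [s] has no coordinate other than the [k]-th, which dies at [I]; yet [f]
   sends its push to 1. *)
have push0 : fmod_map F theta sI v = 0.
  apply: p_sep => j; rewrite p_push; case: asboolP => // JjI.
  by apply: v0 => jk; apply: nJI; rewrite -jk.
by have := fp v; rewrite /= -[block_push _ _]/(fmod_map F theta sI v) push0 linear0 v1
  => /esym/eqP; rewrite oner_eq0.
Qed.

Lemma mem_interval k I : (forall t, cint_set I t -> live t) ->
  Jk k I <-> cint_set I `<=` diagonal_slice (J k).
Proof.
move=> lI; split=> [JI t It|]; first exact: interval_points JI It (lI t It).
exact: interval_of_points.
Qed.

(** The summands containing [I] have dual vectors there, and all other coordinates vanish at [I], so
    [card_dual_family] applies. *)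
Lemma card_interval I : [set k | Jk k I] #= `I_#|blocks_of (joinc I)|.
Proof.
have -> : #|blocks_of (joinc I)| = #|block (joinc I)| by rewrite card_sig.
apply: (@card_dual_family F _ K _ (fun k => p k I)) => [k|v v0].
  exact: p_dual.
apply: p_sep => k; have [/eqP//|/coef_support] := boolP (p k I v == 0).
exact: v0.
Qed.

(* Pushing from [t] to the hull of [t] and [u] is the identity. *)
Lemma point_stable k t u :
  (forall r, between t u r -> theta r = theta t) ->
  Jk k (cint_point t) -> Jk k (cint_point u).
Proof.
move=> theta_tu Jt.
have ht : cint_set (hull t u) t by apply/hullP; exact: between_l.
have hu : cint_set (hull t u) u by apply/hullP; exact: between_r.
have joinE : joinc (cint_point t) = joinc (hull t u).
  apply/le_anti/andP; split; apply: join_over_lub => r.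
    by move=> /cint_point_set ->; exact: le_join_over.
  by move/hullP/theta_tu->; exact/le_join_over/cint_point_mem.
have [v [v1 v0]] := p_dual Jt.
have th := cint_point_le ht.
have Jh : Jk k (hull t u).
  apply: contrapT => nJh; have : fmod_map F theta th v = 0.
    apply: p_sep => j; rewrite p_push; case: asboolP => // Jj.
    by apply: v0 => jk; apply: nJh; rewrite -jk.
  rewrite -(linear0 (fmod_map F theta th)) => /(block_push_inj joinE) v_eq0.
  by move: v1; rewrite v_eq0 linear0 => /esym/eqP; rewrite oner_eq0.
apply: interval_points Jh hu _; have [x xt] := point_live Jt.
by exists x; rewrite theta_tu //; exact: between_r.
Qed.

Lemma bar_nonempty k : exists t, Jk k (cint_point t).
Proof.
have [A JA] := pitv_nonempty (J k).
by have [t [_ Jt _]] := interval_has_point JA; exists t.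
Qed.

(** * Bars as unions of cells, and their number over a cell range *)

Hypothesis theta_cell : forall s t, cell s = cell t -> theta s = theta t.

Lemma bar_cell k s t : cell s = cell t ->
  Jk k (cint_point s) -> Jk k (cint_point t).
Proof.
move=> st; apply: point_stable => r str; apply: theta_cell.
by case/orP: str => /andP[/cell_mono h1 /cell_mono h2]; lia.
Qed.

(** By saturation the partition into singletons lies below every [theta t], so the meet covers [X]
    and the restriction removes nothing. *)
Lemma diamond_live (E : set R) : (forall t, E t -> live t) ->
  blocks_of (diamond theta E) = blocks_of (join_over theta E).
Proof.
move=> lE.
have meetT : finset.cover (meet_over theta E) = [set: X]%SET.
  pose e : rel X := fun x y => x == y.
  have es : symmetric e := @eq_sym X.
  have et : transitive e by move=> ? ? ?; rewrite /e => /eqP-> /eqP->.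
  have le_meet : (per_subpart es et <= meet_over theta E)%O.
    apply: meet_over_glb => t /lE lt; apply/subpart_leP => x y.
    rewrite same_block_per => /eqP <-; rewrite same_block_cover.
    exact: live_cover.
  apply/finset.setP => x; rewrite finset.inE; apply: cover_le le_meet _.
  by rewrite -same_block_cover same_block_per /e.
rewrite /diamond meetT; apply/finset.setP => B; apply/imsetP/idP => [[C]|PB].
  by rewrite finset.inE finset.setIT => /andP[PC _] ->.
exists B; rewrite ?finset.inE finset.setIT // PB /=.
exact: (block_n0 (exist _ B PB)).
Qed.

Lemma diamond_dead (E : set R) t : E t -> ~ live t ->
  blocks_of (diamond theta E) = finset.set0.
Proof.
move=> Et nlt; apply/finset.setP => B; rewrite finset.in_set0.
apply/negP => /imsetP[C]; rewrite finset.inE => /andP[_ /finset.set0Pn[x]].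
rewrite finset.inE => /andP[_ /(cover_le (meet_over_le theta Et)) xt].
by case: nlt; exists x.
Qed.

Definition bars_over (E : set R) : set K := [set k | E `<=` diagonal_slice (J k)].

(** The module only sees closed intervals, while a cell range may have open ends. The closed hull
    [I] of the midpoints of the two end cells meets the same cells, hence has the same join and lies
    in the same bars. *)
Lemma card_bars_over (lo hi : int) : lo <= hi ->
  bars_over (cell_range lo hi) #= `I_#|blocks_of (diamond theta (cell_range lo hi))|.
Proof.
move=> pq; set E := cell_range lo hi.
(* A dead time in [E] empties the diamond, and no bar passes through it. *)
have [lE|] := pselect (forall t, E t -> live t); last first.
  move/existsNP => [t /not_implyP[Et nlt]]; rewrite (diamond_dead Et nlt) cards0.
  suff -> : bars_over E = set0 by rewrite II0.
  by apply/seteqP; split=> // k /(_ _ Et)/point_live.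
rewrite (diamond_live lE); pose I := hull (cell_mid R lo) (cell_mid R hi).
have IE : cint_set I `<=` E.
  move=> t /hullP; rewrite /E /cell_range /=.
  by case/orP => /andP[/cell_mono + /cell_mono]; rewrite !cell_midK; lia.
have midI t : E t -> cint_set I (cell_mid R (cell t)).
  by rewrite /E /cell_range /= => /andP[pt tq]; apply/hullP;
    rewrite /between (cell_mid_le R pt) (cell_mid_le R tq).
have midE t : theta (cell_mid R (cell t)) = theta t.
  by apply: theta_cell; rewrite cell_midK.
have -> : join_over theta E = joinc I.
  apply/le_anti/andP; split; last exact: join_over_le.
  by apply: join_over_lub => t /midI It; rewrite -midE; exact: le_join_over.
suff -> : bars_over E = [set k | Jk k I] by exact: card_interval.
apply/seteqP; split=> k /=.
  move=> ED; apply/mem_interval => t /IE; [exact: lE|exact: ED].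
move/mem_interval => h t /midI/(h (fun u Iu => lE u (IE u Iu))) Dm.
by apply: bar_cell Dm; rewrite cell_midK.
Qed.

Hypothesis support_bounded : exists M, forall t, live t -> `|t| <= M.

(** A bar is a nonempty union of cells, bounded by the support and convex by [bar_points], so its
    extreme cell numbers determine it. *)
Lemma bar_cell_range k :
  exists lo hi : int, lo <= hi /\ diagonal_slice (J k) = cell_range lo hi.
Proof.
have [M leM] := support_bounded.
pose D := diagonal_slice (J k).
have [t0 Dt0] : exists t, D t := bar_nonempty k.
have D_mid t : D t <-> D (cell_mid R (cell t)).
  by split; apply: bar_cell; rewrite cell_midK.
have D_le m : D (cell_mid R m) -> `|m| <= Num.ceil (M * 2).
  move/point_live/leM; rewrite /cell_mid normrM normfV (@ger0_norm _ 2) //.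
  rewrite ler_pdivrMr // -intr_norm => h.
  by rewrite -(ler_int R); apply: le_trans h (ceil_ge _).
(* The sign [sg] treats the maximum and the minimum at once: the search maximizes a natural distance
   from the cell of [t0] in direction [sg]. *)
have extremum (sg : int) : sg = 1 \/ sg = -1 ->
    exists m, D (cell_mid R m) /\ forall n, D (cell_mid R n) -> sg * n <= sg * m.
  move=> sgE; pose P n := `[< D (cell_mid R (cell t0 + sg * n%:Z)) >].
  have exP : exists n, P n by exists 0%N; apply/asboolP; rewrite mulr0 addr0 -D_mid.
  have ubP n : P n -> (n <= absz (Num.ceil (M * 2)) + absz (cell t0))%N.
    move/asboolP/D_le; move: (Num.ceil _) (cell t0) => c a.
    by case: sgE => ->; lia.
  have [n Pn max_n] := ex_maxnP exP ubP.
  exists (cell t0 + sg * n%:Z); split=> [|m Dm]; first exact/asboolP.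
  have max_m : P (absz (m - cell t0)) -> (absz (m - cell t0) <= n)%N by exact: max_n.
  have Pm : sg * cell t0 <= sg * m -> P (absz (m - cell t0)).
    move=> le_m; apply/asboolP.
    suff -> : cell t0 + sg * (absz (m - cell t0))%:Z = m by [].
    by move: (cell t0) le_m => a; case: sgE => ->; lia.
  have [/Pm/max_m|] := leP (sg * cell t0) (sg * m).
    by move: (cell t0) => a; case: sgE => ->; lia.
  by move: (cell t0) => a; case: sgE => ->; lia.
have [hi [Dhi lehi]] := extremum 1 (or_introl erefl).
have [lo [Dlo lelo]] := extremum (-1) (or_intror erefl).
have pq : lo <= hi by have := lehi _ Dlo; lia.
exists lo, hi; split=> //; apply/seteqP; split=> t.
  by move/D_mid => Dt; have := lehi _ Dt; have := lelo _ Dt; rewrite /cell_range /=; lia.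
rewrite /cell_range /= => /andP[pt tq]; apply/D_mid.
by apply: (bar_points Dlo Dhi _).1;
  rewrite /between (cell_mid_le R pt) (cell_mid_le R tq).
Qed.

End Components.

(** * Cell ranges, integer intervals and integer critical points *)

Section CellRange.
Variable R : realType.
Implicit Types p q : int.

Lemma cell_range_sub p q p' q' : p <= q ->
  @cell_range R p q `<=` @cell_range R p' q' <-> p' <= p /\ q <= q'.
Proof.
move=> pq; split=> [h|[pp qq] t]; last by rewrite /cell_range /=; lia.
have := h (cell_mid R p); have := h (cell_mid R q).
by rewrite /cell_range /= !cell_midK; lia.
Qed.

Lemma cell_range_inj p q p' q' : p <= q ->
  @cell_range R p q = @cell_range R p' q' -> p = p' /\ q = q'.
Proof.
move=> pq E.
have /(cell_range_sub _ _ pq)[pp qq] : @cell_range R p q `<=` @cell_range R p' q'.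
  by rewrite E.
have pq' : p' <= q' by lia.
have /(cell_range_sub _ _ pq')[] : @cell_range R p' q' `<=` @cell_range R p q.
  by rewrite E.
by lia.
Qed.

(** Closing an open end adds the cell of an integer; opening a closed end outward adds the adjacent
    open unit interval. *)
Lemma zitv_cell_range i : zitv R i ->
  exists p q, [/\ p <= q, zset R i = @cell_range R p q,
    zset R (zitv_left i) = @cell_range R (p - 1) q
    & zset R (zitv_right i) = @cell_range R p (q + 1)].
Proof.
case=> -[b [a [c [d ->]]]]; rewrite zset_cell_range => -[t /andP[pt tq]].
exists (2 * a + (~~ b)%:Z), (2 * d - c%:Z); split=> //; first exact: le_trans pt tq.
  by case: b {pt} => /=; rewrite zset_cell_range; congr cell_range => /=; lia.
by case: c {tq} => /=; rewrite zset_cell_range; congr cell_range => /=; lia.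
Qed.

Lemma cell_range_zitv p q : p <= q ->
  exists2 i, zitv R i & @cell_range R p q = zset R i.
Proof.
(* Parity decides the type of an end: even cell numbers give closed ends, odd ones open ends. *)
move=> pq; have [b [a pE]] : exists (b : bool) (a : int), p = 2 * a + (~~ b)%:Z.
  by exists ((p %% 2)%Z == 0), (p %/ 2)%Z; case: eqP => /=; lia.
have [c [d qE]] : exists (c : bool) (d : int), q = 2 * d - c%:Z.
  by exists ((q %% 2)%Z != 0), ((q + 1) %/ 2)%Z; case: eqP => /=; lia.
have E : @cell_range R p q = zset R (Interval (BSide b a) (BSide c d)).
  by rewrite zset_cell_range -pE -qE.
exists (Interval (BSide b a) (BSide c d)) => //; split; first by exists b, a, c, d.
by rewrite -E; exists (cell_mid R p); rewrite /cell_range /= cell_midK lexx.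
Qed.

End CellRange.

(** An open unit cell is connected and contains no integer, so it lies in one component of the
    complement of [C]. *)
Lemma critical_int_cell (R : realType) (X : finType) (theta : R -> subpart X) C :
  critical_points theta C -> C `<=` [set z%:~R | z in [set: int]] ->
  forall s t, cell s = cell t -> theta s = theta t.
Proof.
move=> [_ theta_const _] CZ s t /cell_eq[-> //|[n [ns nt]]].
pose U : set R := [set` `]n%:~R, (n + 1)%:~R[ ].
have UC : U `<=` ~` C.
  move=> u; rewrite /U /= in_itv /= => /andP[nu un] /CZ[z _ zu].
  by move: nu un; rewrite -zu !ltr_int; lia.
have [Us Ut] : U s /\ U t by rewrite /U /= !in_itv.
apply/esym/theta_const; first exact: UC.
exists U => //; split=> //.
exact/connected_intervalP/interval_is_interval.
Qed.

(** * Coefficient sums and the final count *)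

Lemma total_coef_Zpow_of (X : finType) (P : subpart X) :
  total_coef (Zpow_of P) = #|blocks_of P|%:Z.
Proof.
rewrite /total_coef -sum1_card -natz natr_sum [RHS]big_mkcond; apply: eq_bigr => B _.
by rewrite ffunE; case: ifP.
Qed.

Lemma total_coefD (X : finType) (m n : Zpow X) :
  total_coef (m + n) = total_coef m + total_coef n.
Proof. by rewrite /total_coef -big_split; apply: eq_bigr => B _; rewrite ffunE. Qed.

Lemma total_coefN (X : finType) (m : Zpow X) : total_coef (- m) = - total_coef m.
Proof. by rewrite /total_coef -sumrN; apply: eq_bigr => B _; rewrite ffunE. Qed.

Theorem theorem6p30 (R : realType) (F : fieldType) (X : finType)
    (theta : formigram R X) (K : Type) (J : K -> poset_interval (cint R)) :
  (0 < #|X|)%N ->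
  saturated theta ->
  bounded_set (formigram_support theta) ->
  (exists2 C : set R, critical_points theta C
     & C `<=` [set z%:~R | z in [set: int]]) ->
  is_barcode (formigram_module F theta) J ->
  (forall k : K, exists2 i : interval int,
     zitv R i & diagonal_slice (J k) = zset R i) /\
  (forall i : interval int, zitv R i ->
     exists2 n : nat, ([set k | diagonal_slice (J k) = zset R i] #= `I_n)%card
       & silhouette theta i = n%:Z).
Proof.
move=> _ sat bounded [C critC CZ] /barcode_functionals[p [p_push p_dual p_sep]].
have theta_cell := critical_int_cell critC CZ.
have support_bounded : exists M, forall t,
    (exists x, x \in finset.cover (theta t)) -> `|t| <= M.
  (* [bounded_set] provides bounds strictly above [M] only, hence the [+ 1]. *)
  have [M [_ leM]] := bounded; exists (M + 1) => t [x xt].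
  by apply: leM; [rewrite ltrDl|exists x].
have bar_range := bar_cell_range sat p_push p_dual p_sep theta_cell support_bounded.
split=> [k|i /zitv_cell_range[lo [hi [lohi iE lE rE]]]].
  have [lo [hi [lohi ->]]] := bar_range k.
  by have [i zi ->] := cell_range_zitv R lohi; exists i.
have lrE : zset R (zitv_left i) `|` zset R (zitv_right i) = cell_range (lo - 1) (hi + 1).
  by rewrite lE rE; apply/seteqP; split=> t; rewrite /cell_range /=; lia.
pose bars m n := bars_over J (@cell_range R m n).
have card_bars (m n : int) : m <= n ->
    bars m n #= `I_#|blocks_of (diamond theta (cell_range m n))|.
  exact: (card_bars_over sat p_push p_dual p_sep theta_cell).
have barsP m n k : m <= n -> forall lo' hi', diagonal_slice (J k) = cell_range lo' hi' ->
    bars m n k <-> lo' <= m /\ n <= hi'.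
  by move=> mn lo' hi' E; rewrite /bars /bars_over /= E; exact: cell_range_sub.
have lo1 : lo - 1 <= hi by lia.
have hi1 : lo <= hi + 1 by lia.
have lohi1 : lo - 1 <= hi + 1 by lia.
(* A bar equals the range of [i] exactly when it contains that range but neither of its one-cell
   enlargements. *)
have -> : [set k | diagonal_slice (J k) = zset R i] =
    bars lo hi `\` (bars lo (hi + 1) `|` bars (lo - 1) hi).
  apply/seteqP; split=> k /=; have [lo' [hi' [lohi' E]]] := bar_range k;
    have bP m n mn := barsP m n k mn lo' hi' E.
    rewrite E iE => /(cell_range_inj lohi')[? ?]; subst lo' hi'.
    by split; [apply/bP|case=> /bP[]//; lia].
  case=> /bP[]// lo_le hi_ge nU; rewrite E iE; congr cell_range.
    apply/eqP/negPn/negP => ne; apply: nU; right; apply/bP => //; lia.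
  apply/eqP/negPn/negP => ne; apply: nU; left; apply/bP => //; lia.
(* A bar is itself a cell range, so containing both one-sided enlargements means containing the
   two-sided one. *)
have barsI : bars lo (hi + 1) `&` bars (lo - 1) hi = bars (lo - 1) (hi + 1).
  apply/seteqP; split=> k; have [lo' [hi' [lohi' E]]] := bar_range k;
    have bP m n mn := barsP m n k mn lo' hi' E.
    by case=> /bP[]// ? ? /bP[]// ? ?; apply/bP => //; lia.
  by case/bP => // ? ?; split; apply/bP => //; lia.
have subl : bars lo (hi + 1) `<=` bars lo hi.
  by move=> k; apply: subset_trans; apply/cell_range_sub => //; lia.
have subr : bars (lo - 1) hi `<=` bars lo hi.
  by move=> k; apply: subset_trans; apply/cell_range_sub => //; lia.
have cardI := card_bars _ _ lohi1; rewrite -barsI in cardI.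
have [m cardE silE] := card_setDU subl subr (card_bars _ _ lohi) (card_bars _ _ hi1)
  (card_bars _ _ lo1) cardI.
exists m => //; rewrite -silE /silhouette /clustergram lrE iE lE rE.
by rewrite !total_coefD !total_coefN !total_coef_Zpow_of.
Qed.
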